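(* Let $\mathcal{M}$ be a finite MDP, $N\in\mathbb{N}$ the agent's decision horizon, $\varphi$ an scLTL formula over $\mathcal{AP}$, and $\overline{\epsilon}>0$. If $\mathcal{P}_{s,a,s'}\in\{0,1\}$ for all $s,s'\in S$ and $a\in\mathcal{A}(s)$, then there exists an $\overline{\epsilon}$-optimal incentive design on $\mathcal{M}$.
   Context: MDP. $\mathcal{M}=(S,s_0,\mathcal{A},\mathcal{P},\mathcal{AP},\mathcal{L},\mathcal{R})$ with finite state set $S$, initial state $s_0$, finite action set $\mathcal{A}$, nonempty sets $\mathcal{A}(s)\subseteq\mathcal{A}$ of available actions, transition probabilities $\mathcal{P}_{s,a,s'}$ with $\sum_{s'}\mathcal{P}_{s,a,s'}=1$ for $a\in\mathcal{A}(s)$, finite set $\mathcal{AP}$ of atomic propositions, labeling $\mathcal{L}:S\to2^{\mathcal{AP}}$, reward $\mathcal{R}:S\times\mathcal{A}\to\mathbb{R}$. A decision rule assigns to each state a probability distribution over its available actions; an $N$-stage policy is a sequence of $N$ decision rules, and $\Pi_N(\mathcal{M})$ denotes the set of these. scLTL. A syntactically co-safe linear temporal logic (scLTL) formula $\varphi$ is interpreted over infinite words on $2^{\mathcal{AP}}$; there is a deterministic finite automaton over the alphabet $2^{\mathcal{AP}}$ such that an infinite word satisfies $\varphi$ iff some finite prefix of it is accepted. A path $s_0s_1\ldots$ of $\mathcal{M}$ satisfies $\varphi$ if the word $\mathcal{L}(s_0)\mathcal{L}(s_1)\ldots$ does. Agent and incentive designs. Stages $t=1,2,\ldots$ are grouped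 in planning periods $k=0,1,2,\ldots$, the $k$-th consisting of stages $kN+1,\ldots,kN+N$. At the start of period $k$ the principal, who has observed the path so far, offers functions $\gamma_{kN+1},\ldots,\gamma_{kN+N}:S\times\mathcal{A}\to\mathbb{R}_{\ge0}$. The rule $\Gamma$ prescribing these offers is an incentive design on $\mathcal{M}$. The agent then computes and implements for $N$ stages an $N$-stage policy $\pi^\star_k\in\Pi_N(\mathcal{M})$ that maximizes, simultaneously for every starting state $s\in S$, $\mathbb{E}^{\pi}_s\big[\sum_{t=1}^N(\mathcal{R}(S_t,A_t)+\gamma_{kN+t}(S_t,A_t))\big]$. An optimal policy of the agent under $\Gamma$ is any resulting overall behavior $\pi^\star=(\pi_0^\star,\pi_1^\star,\ldots)$. The incentive $\gamma_t(s,a)$ is paid only if action $a$ is taken in $s$ at stage $t$, so the cost of $\Gamma$ is $\mathbb{E}^{\pi^\star}_{s_0}\big[\sum_{t=1}^\infty\gamma_t(S_t,A_t)\big]$. $\overline\epsilon$-optimality. $\Gamma$ is feasible if the agent's optimal policy under $\Gamma$ satisfies $\varphi$ with the maximum probability achievable by any (history-dependent) policy from $s_0$. If the agent has several optimal policies, feasibility is required for all of them and the cost is the supremum over them. For $\overline\epsilon>0$, a design is $\overline{\epsilon}$-optimal if it is feasible and its cost is at most $\overline\epsilon$ plus the infimum of the costs of all feasible designs on $\mathcal{M}$. *)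

(* Defs.v *)
From HB Require Import structures.
From mathcomp Require Import all_boot all_order all_algebra.
From mathcomp Require Import all_classical all_reals all_analysis.

Set Implicit Arguments.
Unset Strict Implicit.
Unset Printing Implicit Defensive.

Import Order.TTheory GRing.Theory Num.Theory.

Local Open Scope classical_set_scope.
Local Open Scope ring_scope.

(* Negation is only allowed in front of atomic propositions, and there is no
   "release" or "always", as syntactic co-safety demands. *)
Inductive scltl (AP : Type) : Type :=
| LTrue
| LFalse
| LAtom of AP
| LNegAtom of AP
| LAnd of scltl AP & scltl AP
| LOr of scltl AP & scltl AP
| LNext of scltl AP
| LUntil of scltl AP & scltl AP
| LEventually of scltl AP.

(* [sat w f i]: the suffix of the infinite word [w] from position [i] on
   satisfies [f]. *)
Fixpoint sat (AP : finType) (w : nat -> {set AP}) (f : scltl AP) (i : nat)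
    : Prop :=
  match f with
  | LTrue => True
  | LFalse => False
  | LAtom p => p \in w i
  | LNegAtom p => p \notin w i
  | LAnd g h => sat w g i /\ sat w h i
  | LOr g h => sat w g i \/ sat w h i
  | LNext g => sat w g i.+1
  | LUntil g h => exists j : nat, [/\ (i <= j)%N, sat w h j &
      forall k : nat, (i <= k < j)%N -> sat w g k]
  | LEventually g => exists2 j : nat, (i <= j)%N & sat w g j
  end.

(* [trans s a] and [reward s a] are meaningful for available [a] only. *)
Record mdp (R : realType) (AP : finType) := Mdp {
  state : finType;
  action : finType;
  init : state;
  avail : state -> {set action};
  avail_neq0 : forall s, avail s != finset.set0;
  trans : state -> action -> state -> R;
  trans_ge0 : forall s a s', a \in avail s -> 0 <= trans s a s';
  trans_sum1 : forall s a, a \in avail s -> \sum_s' trans s a s' = 1;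
  label : state -> {set AP};
  reward : state -> action -> R }.

Section policies.
Context {R : realType} {AP : finType} (M : mdp R AP).

Record action_dist (s : state M) := ActionDist {
  action_prob :> action M -> R;
  action_prob_ge0 : forall a, 0 <= action_prob a;
  action_prob_supp : forall a, a \notin avail s -> action_prob a = 0;
  action_prob_sum1 : \sum_a action_prob a = 1 }.

Definition decision_rule := forall s : state M, action_dist s.

Definition stage_policy (N : nat) := 'I_N -> decision_rule.

(* The pairs (S_t, A_t) of the stages already completed, oldest first; the
   current state is not included. *)
Definition history := seq (state M * action M).

Definition policy := history -> decision_rule.

Definition arrival_prob (s0 : state M) (h : history) (s : state M) : R :=
  if h is x :: h' then let y := last x h' in trans y.1 y.2 s
  else (s == s0)%:R.

(* Probability that the first [n] stages, started in [s0] and controlled by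
   the decision rules [d], produce exactly the state-action pairs [u]. *)
Definition trajectory_prob (s0 : state M) (n : nat) (d : 'I_n -> decision_rule)
    (u : n.-tuple (state M * action M)) : R :=
  \prod_(i < n) (arrival_prob s0 (take i u) (tnth u i).1 *
                 d i (tnth u i).1 (tnth u i).2).

Definition history_prob (pi : policy) (u : history) : R :=
  trajectory_prob (init M) (fun i => pi (take i u)) (in_tuple u).

End policies.

(* Infinite executions: [w t = (S_{t+1}, A_{t+1})], stages being numbered from
   1 in the mathematics and from 0 here. *)
Definition run (R : realType) (AP : finType) (M : mdp R AP) :=
  nat -> state M * action M.

Definition cylinder (R : realType) (AP : finType) (M : mdp R AP)
    (u : history M) : set (run M) := [set w | mkseq w (size u) = u].

Section run_measurable.
Context {R : realType} {AP : finType} (M : mdp R AP).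

Lemma avail_ex : exists a, a \in avail (init M).
Proof. by apply/set0Pn/avail_neq0. Qed.

Definition default_pair : state M * action M := (init M, xchoose avail_ex).

HB.instance Definition _ := gen_eqMixin (run M).
HB.instance Definition _ := gen_choiceMixin (run M).
HB.instance Definition _ :=
  isPointed.Build (run M) (fun=> default_pair).
HB.instance Definition _ :=
  @isMeasurable.Build (sigma_display (range (@cylinder R AP M))) (run M)
    <<s range (@cylinder R AP M) >> (@sigma_algebra0 _ setT _)
    (@sigma_algebraC (run M) _)
    (@sigma_algebra_bigcup _ setT _).

Lemma measurable_cylinder (u : history M) : measurable (cylinder u).
Proof. by apply: sub_sigma_algebra; exists u. Qed.

End run_measurable.

(* Any consistent family of cylinder weights extends to a probability: runs
   are sampled from a uniform point of [0, 1[ by nested subdivision. *)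
Section extension.
Context {R : realType} {AP : finType} (M : mdp R AP).
Let X : finType := (state M * action M)%type.
Context (W : history M -> R).
Context (W_ge0 : forall u, 0 <= W u).
Context (W_nil : W [::] = 1).
Context (W_rcons : forall u, \sum_(x : X) W (rcons u x) = W u).

Let offset (u : history M) (k : nat) : R :=
  \sum_(x : X | (enum_rank x < k)%N) W (rcons u x).

Let left_aux (acc : history M * R) (x : X) : history M * R :=
  (rcons acc.1 x, acc.2 + offset acc.1 (enum_rank x)).

Let left (u : history M) : R := (foldl left_aux ([::], 0) u).2.

Let left_fst u : (foldl left_aux ([::], 0) u).1 = u.
Proof. by elim/last_ind: u => // u x ih; rewrite foldl_rcons /= ih. Qed.

Let left_rcons u x : left (rcons u x) = left u + offset u (enum_rank x).
Proof. by rewrite /left foldl_rcons /= left_fst. Qed.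

Let cell (u : history M) (r : R) : bool := (left u <= r) && (r < left u + W u).

Let offset0 u : offset u 0 = 0.
Proof. by rewrite /offset big_pred0. Qed.

Let offsetT u : offset u #|X| = W u.
Proof.
by rewrite /offset -W_rcons; apply: eq_bigl => x; rewrite ltn_ord.
Qed.

Let offsetS u (x : X) :
  offset u (enum_rank x).+1 = offset u (enum_rank x) + W (rcons u x).
Proof.
rewrite /offset (bigD1 x) //= addrC; congr (_ + _).
apply: eq_bigl => y; rewrite ltnS ltn_neqAle andbC; congr (_ && _).
by rewrite -(inj_eq enum_rank_inj).
Qed.

Let le_offset u k l : (k <= l)%N -> offset u k <= offset u l.
Proof.
move=> kl; rewrite /offset [leRHS](bigID (fun x => (enum_rank x < k)%N)) /=.
rewrite [X in _ <= X + _](eq_bigl (fun x : X => (enum_rank x < k)%N)).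
  by rewrite lerDl; apply: sumr_ge0.
by move=> x; case: (ltnP (enum_rank x) k); rewrite ?andbF// andbT => /leq_trans; apply.
Qed.

Let cell_rcons u x r : cell (rcons u x) r ->
  offset u (enum_rank x) <= r - left u < offset u (enum_rank x).+1.
Proof.
by rewrite /cell left_rcons offsetS -addrA -lerBrDl -ltrBlDl.
Qed.

Let cell_parent u x r : cell (rcons u x) r -> cell u r.
Proof.
move=> /cell_rcons/andP[h1 h2]; rewrite /cell -subr_ge0 -ltrBlDl -offsetT.
apply/andP; split; last by apply: lt_le_trans h2 _; apply: le_offset.
by apply: le_trans h1; rewrite -(offset0 u); apply: le_offset.
Qed.

Let cell_inj u x y r : cell (rcons u x) r -> cell (rcons u y) r -> x = y.
Proof.
move=> /cell_rcons/andP[x1 x2] /cell_rcons/andP[y1 y2].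
apply: enum_rank_inj; apply/val_inj/eqP; rewrite eqn_leq; apply/andP; split.
- rewrite leqNgt; apply/negP => /(le_offset u) h.
  by have := lt_le_trans y2 (le_trans h x1); rewrite ltxx.
- rewrite leqNgt; apply/negP => /(le_offset u) h.
  by have := lt_le_trans x2 (le_trans h y1); rewrite ltxx.
Qed.

Let cell_child u r : cell u r -> exists x, cell (rcons u x) r.
Proof.
rewrite /cell -subr_ge0 -ltrBlDl -offsetT => /andP[r0 rT].
have [k [kX h1 h2]] : exists k, [/\ (k < #|X|)%N,
    offset u k <= r - left u & r - left u < offset u k.+1].
  elim: #|X| {-2}(#|X|) (leqnn #|X|) rT => [|n ih] [|m] // mn rT;
    try by move: rT; rewrite offset0 ltNge r0.
  have [h|h] := ltP (r - left u) (offset u m); last by exists m.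
  by have [k [km h1 h2]] := ih m mn h; exists k; split => //; exact: ltnW.
exists (enum_val (Ordinal kX)).
by rewrite /cell left_rcons -addrA -lerBrDl -ltrBlDl -offsetS enum_valK /= h1 h2.
Qed.

Let next (u : history M) (r : R) : X :=
  odflt (default_pair M) [pick x | cell (rcons u x) r].

Let nextP u r : cell u r -> cell (rcons u (next u r)) r.
Proof.
move=> /cell_child[x cx]; rewrite /next; case: pickP => //= /(_ x).
by rewrite cx.
Qed.

Let next_out u r : ~~ cell u r -> next u r = default_pair M.
Proof. by move=> ncu; rewrite /next; case: pickP => //= x /cell_parent; rewrite (negbTE ncu). Qed.

Let approx (r : R) (n : nat) : history M :=
  iter n (fun u => rcons u (next u r)) [::].

Let sample (r : R) : run M := fun n => next (approx r n) r.

Let mkseq_sample r n : mkseq (sample r) n = approx r n.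
Proof.
by elim: n => [|n ih]; [by []|rewrite mkseqS ih].
Qed.

Let approx_in r n : cell [::] r -> cell (approx r n) r.
Proof. by move=> c0; elim: n => [|n ih]; [exact: c0|exact: (nextP ih)]. Qed.

Let cell_nil u r : cell u r -> cell [::] r.
Proof. by elim/last_ind: u => // u x ih /cell_parent. Qed.

Let approx_cell u r : cell u r -> approx r (size u) = u.
Proof.
elim/last_ind: u => // u x ih cux; rewrite size_rcons /=.
have cu := cell_parent cux; have := ih cu; rewrite /approx /= => ->.
by congr rcons; exact: cell_inj (nextP cu) cux.
Qed.

Let approx_out r n : ~~ cell [::] r -> approx r n = nseq n (default_pair M).
Proof.
move=> c0; elim: n => // n ih; rewrite /= in ih *; rewrite /approx /= -/(approx r n) ih.
rewrite next_out; last by apply: contra c0; exact: cell_nil.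
by rewrite -cats1 -[[:: _]]/(nseq 1 _) -nseqD addn1.
Qed.

Let cellE u : [set r | cell u r] = `[left u, left u + W u[%classic.
Proof. by apply/seteqP; split => r /=; rewrite in_itv. Qed.

Let mcell u : measurable ([set r | cell u r] : set (measurableTypeR R)).
Proof. by rewrite cellE; exact: measurable_itv. Qed.

Let sample_cylinder u : sample @^-1` cylinder u =
  [set r | cell u r] `|`
  (if u == nseq (size u) (default_pair M) then ~` [set r | cell [::] r] else set0).
Proof.
apply/seteqP; split => r; rewrite /cylinder /= mkseq_sample.
- move=> e; have [c0|c0] := boolP (cell [::] r).
    by left; rewrite -e; exact: approx_in.
  by right; rewrite -{1}e (approx_out _ c0) eqxx; exact/negP.
- case=> [/approx_cell//|]; case: eqP => // -> /negP c0.
  by rewrite size_nseq approx_out.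
Qed.

Let msample : measurable_fun [set: measurableTypeR R] sample.
Proof.
apply: (@measurability _ _ _ _ setT sample (range (@cylinder R AP M))) => //.
move=> _ [_ [u _ <-] <-]; rewrite setTI sample_cylinder.
apply: measurableU; first exact: mcell.
by case: ifP => _ //; apply: measurableC; exact: mcell.
Qed.

Let mcell0 : measurable ([set r | cell [::] r] : set (measurableTypeR R)) :=
  mcell [::].

Let P0 : set (run M) -> \bar R :=
  pushforward (mrestr (@lebesgue_measure R) mcell0) sample.

Let P0cyl u : P0 (cylinder u) = (W u)%:E.
Proof.
rewrite /P0 /pushforward sample_cylinder /mrestr.
have -> : ([set r | cell u r] `|`
  (if u == nseq (size u) (default_pair M) then ~` [set r | cell [::] r] else set0))
  `&` [set r | cell [::] r] = [set r | cell u r].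
  apply/seteqP; split => r /=.
    by case=> -[//|]; case: ifP.
  by move=> cu; split; [left|exact: cell_nil cu].
rewrite cellE lebesgue_measure_itv /= lte_fin.
have [lt0|] := ltP; first by rewrite -EFinB addrC addKr.
by rewrite gerDl => h; congr (_%:E); apply/eqP; rewrite eq_le W_ge0 h.
Qed.

Lemma weight_extension :
  exists P : probability (run M) R, forall u, P (cylinder u) = (W u)%:E.
Proof.
have [mu muE] : exists mu : {measure set (run M) -> \bar R}, mu =1 P0.
  by exists (measure_function_pushforward__canonical__measure_function_Measure
    (mrestr (@lebesgue_measure R) mcell0) msample).
have muT : mu setT = 1%E.
  have -> : [set: run M] = cylinder [::] by apply/seteqP; split.
  by rewrite muE P0cyl W_nil.
exists (mnormalize mu (@dirac _ (run M) point R)) => u.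
rewrite /= /mnormalize; case: ifPn => [|_]; first by rewrite (muT : mu setT = _) onee_eq0.
rewrite (_ : mu setT = 1%E) // invr1 mule1.
by rewrite muE P0cyl.
Qed.

End extension.

Section induced_measure.
Context {R : realType} {AP : finType} (M : mdp R AP).
Implicit Types (pi : policy M) (u : history M).

Lemma history_prob_rcons pi u x : history_prob pi (rcons u x) =
  history_prob pi u * (arrival_prob (init M) u x.1 * pi u x.1 x.2).
Proof.
have E v : history_prob pi v = \prod_(i < size v)
    (arrival_prob (init M) (take i v) (nth (default_pair M) v i).1 *
     pi (take i v) (nth (default_pair M) v i).1 (nth (default_pair M) v i).2).
  by apply: eq_bigr => i _; rewrite !(tnth_nth (default_pair M)).
rewrite !E size_rcons big_ord_recr /= nth_rcons ltnn eqxx; congr (_ * _).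
  by apply: eq_bigr => i _; rewrite nth_rcons ltn_ord -cats1 takel_cat // ltnW.
by rewrite -cats1 take_size_cat.
Qed.

Lemma history_prob_nil pi : history_prob pi [::] = 1.
Proof. by rewrite /history_prob /trajectory_prob big_ord0. Qed.

Lemma history_prob_unavail pi u x :
  x.2 \notin avail x.1 -> history_prob pi (rcons u x) = 0.
Proof.
by move=> h; rewrite history_prob_rcons (action_prob_supp _ h) !mulr0.
Qed.

Lemma history_prob_ge0 pi u : 0 <= history_prob pi u.
Proof.
elim/last_ind: u => [|u x ih]; first by rewrite history_prob_nil.
case: (lastP u) ih => [|v y] ih.
  rewrite history_prob_rcons; apply: mulr_ge0.
    by rewrite history_prob_nil.
  apply: mulr_ge0; [by rewrite /arrival_prob /= ler0n|exact: action_prob_ge0].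
have [ya|ya] := boolP (y.2 \in avail y.1); last first.
  by rewrite history_prob_rcons (history_prob_unavail _ _ ya) mul0r.
rewrite history_prob_rcons; do 2?apply: mulr_ge0 => //.
  rewrite /arrival_prob; case: v {ih} => [|z v] /=; first exact: trans_ge0.
  by rewrite last_rcons; exact: trans_ge0.
exact: action_prob_ge0.
Qed.

Lemma history_prob_sum pi u :
  \sum_x history_prob pi (rcons u x) = history_prob pi u.
Proof.
under eq_bigr do rewrite history_prob_rcons.
rewrite -mulr_sumr -(pair_bigA _ (fun s a => arrival_prob (init M) u s * pi u s a)) /=.
under eq_bigr do rewrite -mulr_sumr action_prob_sum1 mulr1.
case: (lastP u) => [|v y].
  rewrite /arrival_prob (bigD1 (init M)) //= eqxx big1 ?addr0 ?mulr1 //.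
  by move=> s /negPf ->.
have [ya|ya] := boolP (y.2 \in avail y.1); last first.
  by rewrite (history_prob_unavail _ _ ya) mul0r.
suff -> : \sum_s arrival_prob (init M) (rcons v y) s = 1 by rewrite mulr1.
rewrite -(trans_sum1 ya); apply: eq_bigr => s _.
by rewrite /arrival_prob; case: v => [|z v] //=; rewrite last_rcons.
Qed.

Lemma run_measure_ex pi :
  exists P : probability (run M) R, forall u, P (cylinder u) = (history_prob pi u)%:E.
Proof.
apply: weight_extension; [exact: history_prob_ge0|exact: history_prob_nil|].
exact: history_prob_sum.
Qed.

(* The law of the execution from [init M] under [pi]; [run_measureE] determines
   it, as cylinders form a pi-system generating the sigma-algebra of [run M]. *)
Definition run_measure pi : probability (run M) R := sval (cid (run_measure_ex pi)).

Lemma run_measureE pi u : run_measure pi (cylinder u) = (history_prob pi u)%:E.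
Proof. exact: svalP (cid (run_measure_ex pi)) u. Qed.

Definition run_word (w : run M) (t : nat) : {set AP} := label (w t).1.

Definition sat_prob (f : scltl AP) (pi : policy M) : \bar R :=
  run_measure pi [set w | sat (run_word w) f 0].

Definition max_sat_prob (f : scltl AP) : \bar R :=
  ereal_sup (range (sat_prob f)).

End induced_measure.

Section incentives.
Context {R : realType} {AP : finType} (M : mdp R AP) (N : nat).

Definition offers := 'I_N -> state M -> action M -> {nonneg R}.

(* At the start of a planning period, the state path observed so far, current
   state included, is mapped to the offers of the [N] stages of the period.
   The number of the period is determined by the length of the path. *)
Definition incentive_design := seq (state M) -> offers.

Definition stage_value (g : offers) (d : stage_policy M N) (s : state M) : R :=
  \sum_(u : N.-tuple (state M * action M)) trajectory_prob s d u *
    \sum_(i < N) (reward (tnth u i).1 (tnth u i).2 +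
                  (g i (tnth u i).1 (tnth u i).2)%:num).

Definition stage_optimal (g : offers) (d : stage_policy M N) : Prop :=
  forall (d' : stage_policy M N) (s : state M),
    stage_value g d' s <= stage_value g d s.

(* The choice made by the agent at the start of each period, given the
   completed stages and the current state. *)
Definition behavior := history M -> state M -> stage_policy M N.

Definition agent_optimal (G : incentive_design) (b : behavior) : Prop :=
  forall (k : nat) (h : history M) (s : state M), size h = (k * N)%N ->
    stage_optimal (G (rcons (map fst h) s)) (b h s).

Context (N_gt0 : (0 < N)%N).

Definition stage_in_period (t : nat) : 'I_N := Ordinal (ltn_pmod t N_gt0).

Definition period_start (t : nat) : nat := (t %/ N * N)%N.

(* If the current stage opens a period, the state at the start of the period
   is the current state [s], which is not part of [h]. *)
Definition behavior_policy (b : behavior) : policy M := fun h s =>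
  let m := period_start (size h) in
  b (take m h) (head s (map fst (drop m h))) (stage_in_period (size h)) s.

Definition incentive_paid (G : incentive_design) (w : run M) (t : nat) : R :=
  (G (mkseq (fun j => (w j).1) (period_start t).+1) (stage_in_period t)
     (w t).1 (w t).2)%:num.

Definition behavior_cost (G : incentive_design) (b : behavior) : \bar R :=
  (\int[run_measure (behavior_policy b)]_w
    \sum_(0 <= t <oo) (incentive_paid G w t)%:E)%E.

Definition design_cost (G : incentive_design) : \bar R :=
  ereal_sup [set behavior_cost G b | b in agent_optimal G].

Definition feasible (f : scltl AP) (G : incentive_design) : Prop :=
  forall b : behavior, agent_optimal G b ->
    sat_prob f (behavior_policy b) = max_sat_prob M f.

Definition eps_optimal (f : scltl AP) (eps : R) (G : incentive_design) : Prop :=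
  feasible f G /\
  (design_cost G <=
     eps%:E + ereal_inf [set design_cost G' | G' in feasible f])%E.

End incentives.

(* Main.v *)
(* The cost of a design is nonnegative (or [-oo], if the agent has no optimal
   behavior), so a single feasible design suffices: one whose cost is within
   [eps] of the infimum then exists among the feasible ones.
   Co-safe formulas are decided on finite prefixes, so if some policy satisfies
   [phi] with positive probability, some history [u] of positive probability
   already guarantees [phi].  By determinism [u] can be followed with probability
   one.  The design that pays, at each stage, for the pair prescribed by [u] a
   bonus exceeding all rewards that can be collected within [N] stages makes
   every optimal policy of the agent follow [u] almost surely.  If no policy
   satisfies [phi] with positive probability, every design is feasible. *)
Require Import Defs.
From mathcomp Require Import all_boot all_order all_algebra.
From mathcomp Require Import all_classical all_reals all_analysis.
From mathcomp Require Import lra.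

Set Implicit Arguments.
Unset Strict Implicit.
Unset Printing Implicit Defensive.

Import Order.TTheory GRing.Theory Num.Theory.

Local Open Scope classical_set_scope.
Local Open Scope ring_scope.

(** * Probabilities of finite histories *)

Lemma sum_tuple_cat (R : realType) (X : finType) (W : seq X -> R)
    (W_rcons : forall u, \sum_x W (rcons u x) = W u) (p : seq X) (n : nat) :
  \sum_(t : n.-tuple X) W (p ++ t) = W p.
Proof.
elim: n p => [|n ih] p.
  rewrite (big_pred1 [tuple]) ?cats0 // => t /=.
  by apply/esym/eqP; rewrite (tuple0 t).
rewrite (reindex (fun y : X * n.-tuple X => [tuple of y.1 :: y.2])) /=; last first.
  exists (fun t => (thead t, [tuple of behead t])) => [[x t]|t] _ /=.
    by rewrite theadE; congr pair; apply: val_inj.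
  by rewrite [RHS]tuple_eta.
rewrite -(pair_bigA _ (fun x (t : n.-tuple X) => W (p ++ x :: t))) /=.
rewrite -[RHS]W_rcons; apply: eq_bigr => x _; rewrite -ih.
by apply: eq_bigr => t _; rewrite cat_rcons.
Qed.

Section weights.
Context {R : realType} {AP : finType} (M : mdp R AP).
Implicit Types (s : state M) (q : policy M) (u v : history M).
Local Notation x0 := (default_pair M).

Lemma arrival_prob_rcons s u (y : state M * action M) (s' : state M) :
  arrival_prob s (rcons u y) s' = trans y.1 y.2 s'.
Proof. by case: u => [|x u] //=; rewrite last_rcons. Qed.

(** For [s = init M] this is [history_prob]; other starting states are needed because a planning
    period may open in any state. *)
Definition weight s q u : R :=
  trajectory_prob s (fun i => q (take i u)) (in_tuple u).

Lemma weightE s q u : weight s q u = \prod_(i < size u)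
  (arrival_prob s (take i u) (nth x0 u i).1 *
   q (take i u) (nth x0 u i).1 (nth x0 u i).2).
Proof. by apply: eq_bigr => i _; rewrite !(tnth_nth x0). Qed.

Lemma weight_nil s q : weight s q [::] = 1.
Proof. by rewrite weightE big_ord0. Qed.

Lemma weight_rcons s q u x : weight s q (rcons u x) =
  weight s q u * (arrival_prob s u x.1 * q u x.1 x.2).
Proof.
rewrite !weightE size_rcons big_ord_recr /= nth_rcons ltnn eqxx; congr (_ * _).
  by apply: eq_bigr => i _; rewrite nth_rcons ltn_ord -cats1 takel_cat // ltnW.
by rewrite -cats1 take_size_cat.
Qed.

Lemma weight_ge0 s q u : 0 <= weight s q u.
Proof.
elim/last_ind: u => [|u x ih]; first by rewrite weight_nil.
case: (lastP u) ih => [|v y] ih.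
  by rewrite weight_rcons weight_nil mul1r mulr_ge0 ?ler0n ?action_prob_ge0.
have [ya|ya] := boolP (y.2 \in avail y.1).
  by rewrite weight_rcons arrival_prob_rcons !mulr_ge0 ?trans_ge0 ?action_prob_ge0.
by rewrite 2!weight_rcons (action_prob_supp _ ya) !(mulr0, mul0r).
Qed.

Lemma weight_sum s q u : \sum_x weight s q (rcons u x) = weight s q u.
Proof.
under eq_bigr do rewrite weight_rcons.
rewrite -mulr_sumr.
rewrite -(pair_bigA _ (fun s' a => arrival_prob s u s' * q u s' a)) /=.
under eq_bigr do rewrite -mulr_sumr action_prob_sum1 mulr1.
case: (lastP u) => [|v y].
  rewrite /arrival_prob (bigD1 s) //= eqxx big1 ?addr0 ?mulr1 //.
  by move=> s' /negPf ->.
have [ya|ya] := boolP (y.2 \in avail y.1); last first.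
  by rewrite weight_rcons (action_prob_supp _ ya) !(mulr0, mul0r).
under eq_bigr do rewrite arrival_prob_rcons.
by rewrite trans_sum1 // mulr1.
Qed.

(** The extensions of [u] by [n] pairs carry together the mass of [u], so they cannot all be
    null. *)
Lemma weight_extend s q u n : weight s q u != 0 ->
  exists t : n.-tuple (state M * action M), weight s q (u ++ t) != 0.
Proof.
move=> u0; apply/existsP; apply: contra_neqT u0 => /existsPn h.
rewrite -(sum_tuple_cat (weight_sum s q) u n) big1 // => t _.
by apply/eqP; rewrite -[_ == _]negbK.
Qed.

(** Some policy produces such a history surely ([weight_follow]); in a deterministic system no other
    history has positive probability ([weight_admissible]). *)
Definition admissible s u := [forall i : 'I_(size u),
  (arrival_prob s (take i u) (nth x0 u i).1 == 1) &&
  ((nth x0 u i).2 \in avail (nth x0 u i).1)].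

Lemma admissibleP s u : reflect (forall i, (i < size u)%N ->
    arrival_prob s (take i u) (nth x0 u i).1 = 1 /\
    (nth x0 u i).2 \in avail (nth x0 u i).1) (admissible s u).
Proof.
apply: (iffP forallP) => [h i iu|h i].
  by have /andP[/eqP] := h (Ordinal iu).
by have [-> ->] := h i (ltn_ord i); rewrite eqxx.
Qed.

(** Arrival depends on the preceding pair only, except at the first pair of the segment, whose own
    state is taken as the start. This restricts a path to one planning period. *)
Lemma admissible_segment s u k n : (k < size u)%N -> admissible s u ->
  admissible (nth x0 u k).1 (take n (drop k u)).
Proof.
move=> ku /admissibleP adm; apply/admissibleP => i.
rewrite size_take_min leq_min size_drop ltn_subRL => /andP[iN iu].
rewrite nth_take // nth_drop; have [arr av] := adm _ iu; split => //.
case: i => [|i] in iN iu arr av *; first by rewrite take0 addn0 /= eqxx.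
rewrite addnS in iu arr *; rewrite take_takel ?(ltnW iN) //.
rewrite (take_nth x0) ?size_drop ?ltn_subRL ?(ltnW iu) // arrival_prob_rcons nth_drop.
by rewrite (take_nth x0) ?(ltnW iu) // arrival_prob_rcons in arr.
Qed.

Lemma point_dist_sum1 (s : state M) (a : action M) :
  \sum_a' (a' == a)%:R = 1 :> R.
Proof.
rewrite (bigD1 a) //= eqxx big1 ?addr0 // => a' /negPf ->; exact: mulr0n.
Qed.

Lemma point_dist_supp (s : state M) (a a' : action M) :
  a \in avail s -> a' \notin avail s -> (a' == a)%:R = 0 :> R.
Proof. by move=> av; case: eqP => // ->; rewrite av. Qed.

Definition point_dist (s : state M) (a : action M) (av : a \in avail s) :
    action_dist s :=
  @ActionDist R AP M s (fun a' => (a' == a)%:R) (fun a' => ler0n R _)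
    (fun a' => point_dist_supp av) (point_dist_sum1 s a).

Lemma some_avail s : exists a, a \in avail s.
Proof. exact/finset.set0Pn/avail_neq0. Qed.

Definition follow u (t : nat) : decision_rule M := fun s =>
  if pselect ((nth x0 u t).2 \in avail s) is left av then point_dist av
  else point_dist (xchooseP (some_avail s)).

Lemma follow_nth u t : (nth x0 u t).2 \in avail (nth x0 u t).1 ->
  follow u t (nth x0 u t).1 (nth x0 u t).2 = 1.
Proof.
by rewrite /follow => av; case: pselect => //= _; rewrite eqxx.
Qed.

Lemma trajectory_follow s n (u : n.-tuple (state M * action M)) :
  admissible s u -> trajectory_prob s (fun i : 'I_n => follow u i) u = 1.
Proof.
move=> /admissibleP adm; rewrite /trajectory_prob big1 // => i _.
rewrite !(tnth_nth x0); have [|-> av] := adm i; first by rewrite size_tuple.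
by rewrite follow_nth // mulr1.
Qed.

Lemma weight_follow s u :
  admissible s u -> weight s (fun h => follow u (size h)) u = 1.
Proof.
move=> adm; rewrite -(@trajectory_follow s _ (in_tuple u) adm).
by apply: eq_bigr => i _; rewrite size_takel // ltnW.
Qed.

Hypothesis deterministic : forall (s s' : state M) (a : action M),
  a \in avail s -> trans s a s' = 0 \/ trans s a s' = 1.

(** A nonzero product has no zero factor, and by determinism a nonzero transition probability is
    1. *)
Lemma weight_admissible s q u : weight s q u != 0 -> admissible s u.
Proof.
rewrite weightE => /prodf_neq0 nz.
have fac i : (i < size u)%N ->
    arrival_prob s (take i u) (nth x0 u i).1 != 0 /\
    (nth x0 u i).2 \in avail (nth x0 u i).1.
  move=> iu; have := nz (Ordinal iu) isT; rewrite mulf_eq0 negb_or /=.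
  move=> /andP[-> act]; split => //; apply: contraNT act => av.
  by rewrite action_prob_supp.
apply/admissibleP => i iu; have [arr av] := fac i iu; split => //.
case: i iu arr {av} => [|i] iu.
  by rewrite take0 /=; case: (_ =P s) => // _; rewrite eqxx.
have [_ av] := fac i (ltnW iu).
rewrite (take_nth x0) 1?ltnW // arrival_prob_rcons.
by case: (deterministic (nth x0 u i.+1).1 av) => -> //; rewrite eqxx.
Qed.

End weights.

(** * Satisfaction through finite prefixes, and near-minimal costs *)

Section satisfaction.
Context {R : realType} {AP : finType} (M : mdp R AP).

(** Once the witness of an until or eventually is fixed, each operator refers to finitely many
    positions, so the prefix lengths obtained for the subformulas have a maximum. *)
Lemma sat_prefix (f : scltl AP) (w : nat -> {set AP}) (i : nat) : sat w f i ->
  exists n, forall w', (forall j, (j < n)%N -> w' j = w j) -> sat w' f i.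
Proof.
elim: f i => [||p|p|g ihg h ihh|g ihg h ihh|g ihg|g ihg h ihh|g ihg] i //=.
- by exists 0%N.
- by move=> pw; exists i.+1 => w' ->.
- by move=> pw; exists i.+1 => w' ->.
- move=> [/ihg[n hn] /ihh[m hm]]; exists (maxn n m) => w' ww'; split.
    by apply: hn => j jn; apply: ww'; rewrite leq_max jn.
  by apply: hm => j jm; apply: ww'; rewrite leq_max jm orbT.
- move=> [/ihg[n hn]|/ihh[n hn]]; exists n => w' ww'; [left|right]; exact: hn.
- exact: ihg.
- move=> [j [ij /ihh[n hn] gk]].
  (* The bounds for [g] at the positions from [i] up to [j] are merged one position at a time. *)
  have [m hm] : exists m, forall w', (forall l, (l < m)%N -> w' l = w l) ->
      forall k, (i <= k < j)%N -> sat w' g k.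
    elim: j {ij hn} gk => [|j ihj] gk.
      by exists 0%N => w' _ k; rewrite ltn0 andbF.
    have [|m hm] := ihj.
      by move=> k /andP[ik kj]; apply: gk; rewrite ik ltnW.
    have [ij|ji] := leqP i j; last first.
      exists 0%N => w' _ k /andP[ik kj].
      by have := leq_trans ji (leq_trans ik kj); rewrite ltnn.
    have [|m' hm'] := ihg j; first by apply: gk; rewrite ij /=.
    exists (maxn m m') => w' ww' k /andP[ik]; rewrite ltnS leq_eqVlt.
    move=> /orP[/eqP ->|kj].
      by apply: hm' => l lm; apply: ww'; rewrite leq_max lm orbT.
    apply: hm; last by rewrite ik.
    by move=> l lm; apply: ww'; rewrite leq_max lm.
  exists (maxn n m) => w' ww'; exists j; split => //.
    by apply: hn => l ln; apply: ww'; rewrite leq_max ln.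
  by apply: hm => l lm; apply: ww'; rewrite leq_max lm orbT.
- by move=> [j ij /ihg[n hn]]; exists n => w' ww'; exists j => //; exact: hn.
Qed.

Let sat_set (f : scltl AP) : set (run M) := [set w | sat (run_word w) f 0].

(** A prefix that decides the formula cuts out a cylinder. As histories are countable, this gives
    measurability, and the set is null as soon as all cylinders inside it are. *)
Lemma sat_set_bigcup (f : scltl AP) : sat_set f =
  \bigcup_(u in [set u : history M | cylinder u `<=` sat_set f]) cylinder u.
Proof.
apply/seteqP; split => [w|w [u /= sub]]; last exact: sub.
move=> /sat_prefix[n hn]; exists (mkseq w n); last by rewrite /cylinder /= size_mkseq.
move=> w'; rewrite /cylinder /= size_mkseq => e; apply: hn => j jn.
rewrite /run_word -(nth_mkseq (default_pair M) w' jn) e.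
by rewrite nth_mkseq.
Qed.

Lemma measurable_sat_set (f : scltl AP) : measurable (sat_set f).
Proof.
rewrite sat_set_bigcup bigcup_mkcond.
apply: countable_bigcupT_measurable; first exact: countableP.
by move=> u; case: ifP => // _; exact: measurable_cylinder.
Qed.

Lemma sat_prob_le1 (f : scltl AP) (q : policy M) : (sat_prob f q <= 1)%E.
Proof. by apply: probability_le1; exact: measurable_sat_set. Qed.

Lemma sat_prob_positive_cylinder (f : scltl AP) (q : policy M) :
  sat_prob f q != 0%E ->
  exists2 u : history M, cylinder u `<=` sat_set f & history_prob q u != 0.
Proof.
apply: contra_neqP => nex; apply: measure_negligible; first exact: measurable_sat_set.
(* Histories are enumerated through their codes; a number that codes no history contributes the
   empty set. *)
pose F n := if unpickle n is Some u then
  (if `[<cylinder u `<=` sat_set f>] then cylinder u else set0) else set0 : set (run M).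
apply: (@negligibleS _ _ _ _ (\bigcup_n F n)).
  rewrite -/(sat_set f) sat_set_bigcup => w [u /= sub uw]; exists (pickle u) => //.
  by rewrite /F pickleK; case: asboolP.
apply: negligible_bigcup => n; rewrite /F.
case: unpickle => [u|]; last exact: negligible_set0.
case: asboolP => sub; last exact: negligible_set0.
exists (cylinder u); split => //; first exact: measurable_cylinder.
apply: etrans (run_measureE q u) _; congr EFin; apply/eqP; apply: contra_notT nex => nz.
by exists u.
Qed.

Lemma sat_prob1 (f : scltl AP) (q : policy M) (u : history M) :
  cylinder u `<=` sat_set f -> history_prob q u = 1 -> sat_prob f q = 1%E.
Proof.
move=> sub q1; apply/eqP; rewrite eq_le sat_prob_le1 /=.
have <- : run_measure q (cylinder u) = 1%E by rewrite run_measureE q1.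
apply: le_measure => //; rewrite inE; first exact: measurable_cylinder.
exact: measurable_sat_set.
Qed.

Lemma design_cost_Ny_or_ge0 (N : nat) (N_gt0 : (0 < N)%N) (G : incentive_design M N) :
  design_cost N_gt0 G = -oo%E \/ (0 <= design_cost N_gt0 G)%E.
Proof.
have [[b Gb]|nopt] := pselect (exists b, agent_optimal G b); last first.
  left; rewrite /design_cost -[RHS](ereal_sup0 R); congr ereal_sup.
  by apply/seteqP; split => // y [b Gb _]; apply: nopt; exists b.
right; apply: le_ereal_sup_tmp; exists (behavior_cost N_gt0 G b); first by exists b.
apply: integral_ge0 => w _; apply: nneseries_ge0 => t _ _.
by rewrite lee_fin /incentive_paid.
Qed.

(** An infimum [-oo] is attained: an element below 0 can only be [-oo] itself. *)
Lemma ereal_inf_approx (A : set \bar R) (eps : R) : 0 < eps -> A !=set0 ->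
  (forall x, A x -> x = -oo%E \/ (0 <= x)%E) ->
  exists2 x, A x & (x <= eps%:E + ereal_inf A)%E.
Proof.
move=> eps0 [a Aa] A0.
case E : (ereal_inf A) => [r| |].
- have [|x Ax] := lb_ereal_inf_adherent eps0 (_ : ereal_inf A \is a fin_num).
    by rewrite E.
  by rewrite E addeC => /ltW; exists x.
- by exists a => //; rewrite addey ?leey.
- have [x Ax xlt] := lb_ereal_infNy_adherent 0 E.
  have [xNy|x0] := A0 x Ax; last by move: x0; rewrite leNgt xlt.
  by exists x => //; rewrite xNy leNye.
Qed.
End satisfaction.

(** * Bonuses that keep the agent on a prescribed path *)

Section forcing.
Context {R : realType} {AP : finType} (M : mdp R AP).
Context (deterministic : forall (s s' : state M) (a : action M),
  a \in avail s -> trans s a s' = 0 \/ trans s a s' = 1).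
Context (N : nat) (N_gt0 : (0 < N)%N).
Implicit Types (s : state M) (g : offers M N) (d : stage_policy M N)
  (u : history M) (v : N.-tuple (state M * action M)).
Local Notation x0 := (default_pair M).

(* Agrees with [d] on the first [N] stages, which are all that matters here. *)
Definition periodic d : policy M := fun h => d (stage_in_period N_gt0 (size h)).

Lemma stage_in_period_ord (i : 'I_N) : stage_in_period N_gt0 i = i.
Proof. by apply: val_inj; rewrite /= modn_small. Qed.

Lemma trajectory_prob_periodic s d v :
  trajectory_prob s d v = weight s (periodic d) v.
Proof.
pose F i := arrival_prob s (take i v) (nth x0 v i).1 *
  periodic d (take i v) (nth x0 v i).1 (nth x0 v i).2.
rewrite weightE -(big_mkord xpredT F) size_tuple big_mkord.
apply: eq_bigr => i _; rewrite /F /periodic !(tnth_nth x0) size_takel.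
  by rewrite stage_in_period_ord.
by rewrite size_tuple ltnW.
Qed.

Lemma trajectory_prob_ge0 s d v : 0 <= trajectory_prob s d v.
Proof. by rewrite trajectory_prob_periodic weight_ge0. Qed.

Lemma trajectory_prob_sum s d :
  \sum_(v : N.-tuple (state M * action M)) trajectory_prob s d v = 1.
Proof.
rewrite -(weight_nil s (periodic d)).
rewrite -(sum_tuple_cat (weight_sum s (periodic d)) [::] N).
by apply: eq_bigr => v _; rewrite trajectory_prob_periodic.
Qed.

Definition payoff g v : R := \sum_(i < N) (reward (tnth v i).1 (tnth v i).2 +
  (g i (tnth v i).1 (tnth v i).2)%:num).

Lemma stage_value_follow g s v : admissible s v ->
  stage_value g (fun i : 'I_N => follow v i) s = payoff g v.
Proof.
move=> adm; set d : stage_policy M N := fun i => follow v i.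
have v1 : trajectory_prob s d v = 1 by exact: trajectory_follow.
have others : \sum_(w | w != v) trajectory_prob s d w = 0.
  have := trajectory_prob_sum s d; rewrite (bigD1 v) //= v1 => /eqP.
  by rewrite -subr_eq0 addrAC subrr add0r => /eqP.
rewrite /stage_value (bigD1 v) //= v1 mul1r [X in _ + X]big1 ?addr0 // => w wv.
by rewrite (psumr_eq0P (fun w _ => trajectory_prob_ge0 s d w) others) // mul0r.
Qed.

(* In a deterministic system any admissible trajectory is produced with
   probability one by some policy, so an optimal policy only mixes maximizers. *)
Lemma optimal_trajectory g d s v v' : stage_optimal g d ->
  weight s (periodic d) v != 0 -> admissible s v' -> payoff g v' <= payoff g v.
Proof.
move=> opt pv adm'.
pose best := [arg max_(w > v' | admissible s w) payoff g w]%O.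
have [adm bestP] : admissible s best /\
    forall w : N.-tuple _, admissible s w -> payoff g w <= payoff g best.
  by rewrite /best; case: arg_maxP.
have ge0 w : 0 <= trajectory_prob s d w * (payoff g best - payoff g w).
  have [->|nz] := eqVneq (trajectory_prob s d w) 0; first by rewrite mul0r.
  rewrite mulr_ge0 ?trajectory_prob_ge0 // subr_ge0 bestP //.
  by rewrite trajectory_prob_periodic in nz; exact: weight_admissible nz.
(* This sum is the expected shortfall of [d] from [best]. Following [best] is a competing policy, so
   optimality of [d] bounds the sum by 0. *)
have sum0 : \sum_w trajectory_prob s d w * (payoff g best - payoff g w) = 0.
  apply/eqP; rewrite eq_le sumr_ge0 // andbT.
  under eq_bigr do rewrite mulrBr.
  rewrite sumrB -mulr_suml trajectory_prob_sum mul1r subr_le0.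
  by rewrite -(stage_value_follow g adm); exact: opt.
have /(_ v isT)/eqP := psumr_eq0P (fun w _ => ge0 w) sum0.
rewrite mulf_eq0 trajectory_prob_periodic (negbTE pv) /= subr_eq0 => /eqP <-.
exact: bestP.
Qed.

Definition reward_bound : R := \sum_(x : state M * action M) `|reward x.1 x.2|.

Lemma reward_le_bound s a : `|reward s a| <= reward_bound.
Proof.
rewrite /reward_bound (bigD1 (s, a)) //= lerDl sumr_ge0 // => *; exact: normr_ge0.
Qed.

Lemma reward_bound_ge0 : 0 <= reward_bound.
Proof. by apply: sumr_ge0 => *; exact: normr_ge0. Qed.

(* More than what the agent can gain over [N] stages by choosing its rewards. *)
Definition bonus : R := reward_bound * N%:R *+ 2 + 1.

Lemma bonus_ge0 : 0 <= bonus.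
Proof.
by rewrite addr_ge0 // mulrn_wge0 // mulr_ge0 // ?reward_bound_ge0 ?ler0n.
Qed.

(** Here [u] is the part of the path inside one period, possibly ending before the period does.
    Optimality holds from every starting state, so the period may be started in the first state of
    [u]. *)
Lemma offered_path_followed g d u : stage_optimal g d ->
  admissible (nth x0 u 0).1 u -> (size u <= N)%N ->
  (forall (i : 'I_N) s a, (g i s a)%:num =
    (if (i < size u)%N && ((s, a) == nth x0 u i) then bonus else 0)) ->
  forall i : 'I_N, (i < size u)%N -> d i (nth x0 u i).1 (nth x0 u i).2 = 1.
Proof.
move=> opt adm uN gE; set s := (nth x0 u 0).1 in adm *.
(* A deviation from [u] at stage [i] forfeits a bonus, which the rewards of the
   other stages cannot make up for. *)
have unique i x : (i < size u)%N ->
    weight s (periodic d) (rcons (take i u) x) != 0 -> x = nth x0 u i.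
  move=> iu nz; apply/eqP; apply: contraT => xu.
  have iN := leq_trans iu uN.
  (* Payoffs compare full periods, so the deviating history and [u] are both prolonged to [N]
     stages. *)
  have [t tnz] := weight_extend (N - i.+1) nz.
  have ts : size (rcons (take i u) x ++ t) == N.
    by rewrite size_cat size_rcons size_tuple size_takel ?subnKC // ltnW.
  have nz1 : weight s (fun h => follow u (size h)) u != 0.
    by rewrite weight_follow // oner_eq0.
  have [t' tnz'] := weight_extend (N - size u) nz1.
  have ts' : size (u ++ t') == N by rewrite size_cat size_tuple subnKC.
  have := @optimal_trajectory g d s (Tuple ts) (Tuple ts') opt tnz
    (weight_admissible deterministic tnz').
  rewrite leNgt => /negP[]; rewrite -subr_gt0 /payoff -sumrB.
  (* At each stage the rewards differ by at most twice [reward_bound], and the trajectory along [u]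
     never gets the smaller bonus; at stage [i] it alone gets one. The size of [bonus] leaves a
     margin of 1. *)
  apply: (@lt_le_trans _ _ (\sum_(j < N) (- (reward_bound *+ 2) +
      (if j == Ordinal iN then bonus else 0)))).
    rewrite big_split /= -big_mkcond big_pred1_eq sumr_const card_ord /bonus.
    by rewrite -[X in X + _]mulr_natr; lra.
  apply: ler_sum => j _; rewrite !(tnth_nth x0) /= !gE.
  rewrite -!surjective_pairing.
  have := reward_le_bound (nth x0 (u ++ t') j).1 (nth x0 (u ++ t') j).2.
  have := reward_le_bound (nth x0 (rcons (take i u) x ++ t) j).1
    (nth x0 (rcons (take i u) x ++ t) j).2.
  set r := reward _ _; set r' := reward (nth x0 (u ++ t') j).1 _.
  rewrite !ler_norml => /andP[? ?] /andP[? ?].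
  rewrite [nth x0 (u ++ t') j]nth_cat; have b0 := bonus_ge0.
  case ju: (j < size u)%N => /=; last first.
    case: eqP => [ji|_]; last by lra.
    by move: ju; rewrite ji /= iu.
  rewrite eqxx.
  case: eqP => [ji|_]; last by case: ifP => _; lra.
  rewrite ji /= nth_cat size_rcons size_takel ?(ltnW iu) // ltnS leqnn.
  rewrite nth_rcons size_takel ?(ltnW iu) // ltnn eqxx (negbTE xu).
  lra.
(* All mass of a prefix of [u] passes to its continuation along [u]. Hence every prefix has weight
   1, and so has each decision along it. *)
have step i : (i < size u)%N -> weight s (periodic d) (rcons (take i u) (nth x0 u i)) =
    weight s (periodic d) (take i u).
  move=> iu; rewrite -[RHS]weight_sum (bigD1 (nth x0 u i)) //= big1 ?addr0 // => x xu.
  by apply/eqP; apply: contraNT xu => /(unique _ _ iu) ->.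
have one i : (i <= size u)%N -> weight s (periodic d) (take i u) = 1.
  elim: i => [|i ih] iu; first by rewrite take0 weight_nil.
  by rewrite (take_nth x0) // step // ih // ltnW.
move=> i iu; have := step i iu; rewrite weight_rcons one ?(ltnW iu) // mul1r.
have /admissibleP/(_ i iu)[-> _] := adm.
by rewrite mul1r /periodic size_takel ?stage_in_period_ord // ltnW.
Qed.

(* The length of the observed state path [l] exceeds by one the number of
   completed stages, so [(size l).-1 + i] is the absolute index of stage [i]. *)
Definition path_design u : incentive_design M N := fun l i s a =>
  if ((size l).-1 + i < size u)%N && ((s, a) == nth x0 u ((size l).-1 + i))
  then NngNum bonus_ge0 else NngNum (lexx 0).

(** Admissibility makes each arrival factor 1. Each decision factor belongs to the optimal policy of
    its period and is 1 by [offered_path_followed], applied to the segment of [u] in that period. *)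
Lemma path_design_followed u b : agent_optimal (path_design u) b ->
  admissible (init M) u -> history_prob (behavior_policy N_gt0 b) u = 1.
Proof.
move=> opt adm; rewrite -[LHS]/(weight (init M) (behavior_policy N_gt0 b) u) weightE.
rewrite big1 // => -[t tu] _ /=.
have /admissibleP/(_ t tu)[-> _] := adm; rewrite mul1r /behavior_policy.
rewrite size_takel ?(ltnW tu) //; set m := period_start N t.
have mt : (m <= t)%N by exact: leq_trunc_div.
have mu := leq_ltn_trans mt tu.
have tE : t = (m + stage_in_period N_gt0 t)%N by exact: divn_eq.
(* If stage [t] opens a period, the list is empty and the default of [head], the current state, is
   the state at the period start. *)
have -> : head (nth x0 u t).1 (map fst (drop m (take t u))) = (nth x0 u m).1.
  move: mt; rewrite leq_eqVlt => /orP[/eqP ->|mt].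
    by rewrite drop_oversize // size_takel // ltnW.
  rewrite -nth0 (nth_map x0) ?size_drop ?size_takel ?subn_gt0 ?(ltnW tu) //.
  by rewrite nth_drop addn0 nth_take.
rewrite take_takel //.
have msize : size (take m u) = m by rewrite size_takel // ltnW.
have := @offered_path_followed _ _ (take N (drop m u))
  (opt (t %/ N)%N (take m u) (nth x0 u m).1 msize).
rewrite size_take_min size_drop nth_take // nth_drop addn0 geq_minl.
move=> /(_ (admissible_segment N mu adm) isT) followed.
have := followed _ (stage_in_period N_gt0 t).
rewrite nth_take // nth_drop -tE; apply.
  move=> i s a; rewrite /path_design size_rcons size_map msize /=.
  rewrite nth_take // nth_drop leq_min ltn_ord /= ltn_subRL.
  by case: ifP.
by rewrite leq_min ltn_ord ltn_subRL -tE.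
Qed.

End forcing.

Theorem corollary1 (R : realType) (AP : finType) (M : mdp R AP) (N : nat)
    (N_gt0 : (0 < N)%N) (phi : scltl AP) (eps : R) (eps_gt0 : 0 < eps)
    (deterministic : forall (s s' : state M) (a : action M), a \in avail s ->
      trans s a s' = 0 \/ trans s a s' = 1) :
  exists G : incentive_design M N, eps_optimal N_gt0 phi eps G.
Proof.
have [G feasG] : exists G : incentive_design M N, feasible N_gt0 phi G.
  have [[q q0]|none] := pselect (exists q : policy M, sat_prob phi q != 0%E).
    have [u sub u0] := sat_prob_positive_cylinder q0.
    have adm : admissible (init M) u by exact: (weight_admissible deterministic u0).
    exists (path_design u) => b opt; apply/eqP; rewrite eq_le.
    rewrite ereal_sup_ubound /=; last by exists (behavior_policy N_gt0 b).
    rewrite (sat_prob1 sub (path_design_followed deterministic N_gt0 opt adm)).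
    by apply: ge_ereal_sup => _ [q' _ <-]; exact: sat_prob_le1.
  have all0 (q : policy M) : sat_prob phi q = 0%E.
    by apply/eqP; apply: contra_notT none => nz; exists q.
  (* All satisfaction probabilities being 0, any design will do; the empty path gives one that pays
     nothing. *)
  exists (path_design [::]) => b _; apply/eqP; rewrite eq_le.
  rewrite ereal_sup_ubound /=; last by exists (behavior_policy N_gt0 b).
  by apply: ge_ereal_sup => _ [q _ <-]; rewrite !all0.
have costs0 : [set design_cost N_gt0 G' | G' in @feasible R AP M N N_gt0 phi] !=set0.
  by exists (design_cost N_gt0 G); exists G.
have [|_ [G' feasG' <-] le] := ereal_inf_approx eps_gt0 costs0; last by exists G'.
by move=> _ [G' _ <-]; exact: design_cost_Ny_or_ge0.
Qed.
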